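(* Let $0<\sigma\le\beta<\infty$. For the Douglas–Rachford iteration $z^{k+1}=((1-\alpha)\mathrm{Id}+\alpha R_{\gamma g}R_{\gamma f})z^k$ applied to $f,g$ proper, closed, convex on a real Hilbert space with $f$ $\sigma$-strongly convex and $\beta$-smooth, the parameters that optimize (minimize) the linear convergence rate bound $$|1-\alpha|+\alpha\,\delta(\gamma),\qquad \delta(\gamma):=\max\left(\frac{\gamma\beta-1}{\gamma\beta+1},\frac{1-\gamma\sigma}{1+\gamma\sigma}\right),$$ over all $\gamma\in(0,\infty)$ and $\alpha\in\left(0,\frac{2}{1+\delta(\gamma)}\right)$ are $\alpha=1$ and $\gamma=\frac{1}{\sqrt{\sigma\beta}}$, and the optimal value of the rate bound is $$\frac{\sqrt{\beta/\sigma}-1}{\sqrt{\beta/\sigma}+1}.$$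
   Context: For a proper, closed, convex $h:\mathcal{H}\to\mathbb{R}\cup\{\infty\}$ on a real Hilbert space $\mathcal{H}$ and $\gamma>0$: $\mathrm{prox}_{\gamma h}(z)=\operatorname{argmin}_x\{\gamma h(x)+\frac12\|x-z\|^2\}$ and $R_{\gamma h}=2\,\mathrm{prox}_{\gamma h}-\mathrm{Id}$. $f$ is $\sigma$-strongly convex if $f-\frac{\sigma}{2}\|\cdot\|^2$ is convex, and $\beta$-smooth if it is differentiable and $\frac{\beta}{2}\|\cdot\|^2-f$ is convex. The rate bound means that for any fixed point $\bar z$ of $R_{\gamma g}R_{\gamma f}$ the iterates satisfy $\|z^{k+1}-\bar z\|\le(|1-\alpha|+\alpha\delta(\gamma))\|z^k-\bar z\|$. *)

(* Defs.v *)
From mathcomp Require Export all_boot all_order all_algebra.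
From mathcomp Require Export all_classical all_reals all_analysis.
Export Order.TTheory GRing.Theory Num.Theory numFieldNormedType.Exports.

Set Implicit Arguments.
Unset Strict Implicit.
Unset Printing Implicit Defensive.

Local Open Scope classical_set_scope.
Local Open Scope ring_scope.

Section ConvexAnalysis.
Context {R : realType} {H : normedModType R}.
Implicit Types h : H -> \bar R.

(* h takes its values in R \cup {+oo} and is not identically +oo. *)
Definition proper h := (forall x, h x != -oo%E) /\ (exists x, h x != +oo%E).

(* Extended-valued convexity; the endpoint weights t = 0, 1 are trivial and left
   out, so that no product 0 * +oo occurs. *)
Definition convex_ext h := forall (x y : H) (t : R), 0 < t < 1 ->
  (h (t *: x + (1 - t) *: y)%R
     <= t%:E * h x + (1 - t)%:E * h y)%E.

(* A function is closed when its epigraph is, i.e. when it is lower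
   semicontinuous. *)
Definition proper_closed_convex h :=
  [/\ proper h, lower_semicontinuous h & convex_ext h].

Definition strongly_convex (sigma : R) h :=
  convex_ext (fun x => h x - (sigma / 2 * `|x| ^+ 2)%:E)%E.

(* Differentiability is Frechet differentiability on the whole space, so it
   includes finiteness of h everywhere. *)
Definition smooth (beta : R) h :=
  [/\ forall x, h x \is a fin_num,
      forall x, differentiable (fun y => fine (h y) : R^o) x
    & convex_function setT
        (fun x : H => beta / 2 * `|x| ^+ 2 - fine (h x) : R^o)].

Definition argmin h : set H := [set x | forall y, (h x <= h y)%E].

(* The argmin is a singleton for h proper, closed and convex, H a Hilbert space
   and gamma > 0; otherwise, if it is empty, the junk value is z. *)
Definition prox (gamma : R) h (z : H) : H :=
  xget z (argmin (fun x => gamma%:E * h x + (2^-1 * `|x - z| ^+ 2)%:E)%E).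

Definition reflected_prox (gamma : R) h (z : H) : H := 2 *: prox gamma h z - z.

Definition douglas_rachford (gamma alpha : R) (f g : H -> \bar R)
    (z : nat -> H) :=
  forall k, z k.+1 =
    (1 - alpha) *: z k
    + alpha *: reflected_prox gamma g (reflected_prox gamma f (z k)).

Definition is_rate_bound (gamma alpha : R) (f g : H -> \bar R) (c : R) :=
  forall zbar : H, reflected_prox gamma g (reflected_prox gamma f zbar) = zbar ->
  forall z : nat -> H, douglas_rachford gamma alpha f g z ->
  forall k, `|z k.+1 - zbar| <= c * `|z k - zbar|.

End ConvexAnalysis.

Section RateBound.
Context {R : realType}.
Implicit Types sigma beta gamma alpha : R.

Definition delta sigma beta gamma : R :=
  Num.max ((gamma * beta - 1) / (gamma * beta + 1))
          ((1 - gamma * sigma) / (1 + gamma * sigma)).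

Definition rate sigma beta gamma alpha : R :=
  `|1 - alpha| + alpha * delta sigma beta gamma.

Definition admissible sigma beta gamma alpha : Prop :=
  0 < gamma /\ 0 < alpha < 2 / (1 + delta sigma beta gamma).

Definition optimal sigma beta gamma alpha : Prop :=
  admissible sigma beta gamma alpha /\
  forall gamma' alpha', admissible sigma beta gamma' alpha' ->
    rate sigma beta gamma alpha <= rate sigma beta gamma' alpha'.

End RateBound.

(* Main.v *)
From mathcomp Require Import lra ring.
Require Import Defs.

Set Implicit Arguments.
Unset Strict Implicit.
Unset Printing Implicit Defensive.

Local Open Scope classical_set_scope.
Local Open Scope ring_scope.

(** Put beta' = gamma beta and sigma' = gamma sigma, so that delta is
    max ((beta' - 1) / (beta' + 1), (1 - sigma') / (1 + sigma')).

    The rate bound. The proximal objective gamma h + 1/2 |. - z|^2 of a closed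
    convex h is lower semicontinuous and strongly convex, so it has a minimizer
    p = prox z [strongly_convex_attains_min], and it grows at least
    quadratically away from p. Rewritten with the inner product, this growth
    says that gamma^-1 (z - p) is a subgradient of h at p, with the modulus of
    strong convexity of h as a quadratic surplus [prox_variational]. For two
    points z, w let d be the difference of their proximal points and e that of
    the residuals z - p. Then z - w = d + e, whereas the reflected points differ
    by d - e. For g, the subgradient inequalities give <d, e> >= 0, that is
    |d - e| <= |d + e|. For f, convexity of beta/2 |.|^2 - f turns the
    subgradient into a quadratic upper bound [quadratic_upper_bound]; the two
    quadratic bounds at both proximal points give
    <e - sigma' d, beta' d - e> >= 0 [gradient_interpolation], which describes a
    ball containing d - e and yields the factor delta [reflection_contraction].
    The triangle inequality for the averaged step
    (1 - alpha) Id + alpha R_g R_f concludes.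

    The optimum. Since 0 <= delta < 1, the rate is minimal at alpha = 1 only,
    with value delta. With the increasing map M x = (x - 1) / (x + 1) one has
    delta = M (max (gamma beta, 1 / (gamma sigma))), and the product of the two
    arguments of the maximum is beta / sigma whatever gamma is: the maximum is at
    least sqrt (beta / sigma), with equality only when the two arguments agree,
    i.e. when gamma = 1 / sqrt (sigma beta). *)

(** * Choice of the parameters *)

Section OptimalParameters.
Context {R : realType}.
Implicit Types sigma beta gamma alpha : R.

Lemma ler_mobius (x y : R) : 0 < x -> 0 < y ->
  ((x - 1) / (x + 1) <= (y - 1) / (y + 1)) = (x <= y).
Proof.
move=> x0 y0; rewrite ler_pdivrMr ?addr_gt0// mulrAC ler_pdivlMr ?addr_gt0//.
by apply/idP/idP => ?; lra.
Qed.

(** The second argument of delta is the image of 1 / (gamma sigma) under the same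
    increasing map as the first. *)
Lemma delta_mobius sigma beta gamma :
  0 < sigma -> 0 < beta -> 0 < gamma ->
  let M := Num.max (gamma * beta) (gamma * sigma)^-1 in
  delta sigma beta gamma = (M - 1) / (M + 1).
Proof.
move=> s0 b0 g0 M.
have u0 : 0 < gamma * beta by rewrite mulr_gt0.
have v0 : 0 < gamma * sigma by rewrite mulr_gt0.
have w0 : 0 < (gamma * sigma)^-1 by rewrite invr_gt0.
have -> : delta sigma beta gamma =
    Num.max ((gamma * beta - 1) / (gamma * beta + 1))
            (((gamma * sigma)^-1 - 1) / ((gamma * sigma)^-1 + 1)).
  congr Num.max; field; rewrite !gt_eqF//; lra.
rewrite {}/M; case: (lerP (gamma * beta) (gamma * sigma)^-1) => h.
  by apply/max_idPr; rewrite ler_mobius.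
by apply/max_idPl; rewrite ler_mobius// ltW.
Qed.

(** The geometric mean lies below the maximum. *)
Lemma sqrt_le_max (x y : R) : 0 < x -> 0 < y ->
  Num.sqrt (x * y) <= Num.max x y ?= iff (x == y).
Proof.
move=> x0 y0; wlog xy : x y x0 y0 / x <= y => [th|].
  case/orP: (le_total x y) => [|yx]; first exact: th.
  by rewrite mulrC maxC eq_sym; apply: th.
have -> : Num.max x y = Num.sqrt (y * y).
  by rewrite -expr2 sqrtr_sqr gtr0_norm//; exact/max_idPr.
apply/leifP; case: eqVneq => [->//|ne].
have lt : x < y by rewrite lt_neqAle ne.
by rewrite ltr_sqrt ?mulr_gt0// ltr_pM2r.
Qed.

(** gamma beta and 1 / (gamma sigma) have product beta / sigma, so balancing them
    is the only way to minimize their maximum. *)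
Lemma optimal_value_le_delta sigma beta gamma :
  0 < sigma -> sigma <= beta -> 0 < gamma ->
  (Num.sqrt (beta / sigma) - 1) / (Num.sqrt (beta / sigma) + 1)
    <= delta sigma beta gamma ?= iff (gamma == 1 / Num.sqrt (sigma * beta)).
Proof.
move=> s0 sb g0; have b0 := lt_le_trans s0 sb.
have u0 : 0 < gamma * beta by rewrite mulr_gt0.
have v0 : 0 < gamma * sigma by rewrite mulr_gt0.
have w0 : 0 < (gamma * sigma)^-1 by rewrite invr_gt0.
have k0 : 0 < Num.sqrt (beta / sigma) by rewrite sqrtr_gt0 divr_gt0.
have M0 : 0 < Num.max (gamma * beta) (gamma * sigma)^-1 by rewrite lt_max u0.
rewrite delta_mobius//.
have := sqrt_le_max u0 w0.
have -> : gamma * beta * (gamma * sigma)^-1 = beta / sigma.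
  by field; rewrite !gt_eqF.
have -> : (gamma * beta == (gamma * sigma)^-1) =
    (gamma == 1 / Num.sqrt (sigma * beta)).
  have m0 : 0 < Num.sqrt (sigma * beta) by rewrite sqrtr_gt0 mulr_gt0.
  have m2 : Num.sqrt (sigma * beta) ^+ 2 = sigma * beta.
    by rewrite sqr_sqrtr// mulr_ge0// ltW.
  rewrite -[gamma * beta]divr1 -[X in _ == X]div1r.
  rewrite -[X in _ = (X == _)]divr1 !eqr_div ?lt0r_neq0// ?mul1r ?mulr1.
  rewrite -[RHS](@eqrXn2 _ 2) ?mulr_ge0 ?ltW// exprMn m2 expr1n.
  by congr (_ == _); ring.
case=> le eq; split; first by rewrite ler_mobius.
by rewrite -eq eq_le [RHS]eq_le !ler_mobius.
Qed.

(** Slopes in alpha: the rate is affine with slope delta - 1 < 0 left of 1 and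
    delta + 1 > 0 right of 1. *)
Lemma delta_le_rate sigma beta gamma alpha :
  0 <= delta sigma beta gamma < 1 -> 0 < alpha ->
  delta sigma beta gamma <= rate sigma beta gamma alpha ?= iff (alpha == 1).
Proof.
rewrite /rate; set d := delta _ _ _ => /andP[d0 d1] a0; apply/leifP.
case: eqVneq => [->|ne]; first by rewrite subrr normr0 add0r mul1r.
case: (ltP alpha 1) => h; first by rewrite ger0_norm; nra.
have {ne}h : 1 < alpha by rewrite lt_neqAle eq_sym ne.
by rewrite ler0_norm; nra.
Qed.

Lemma delta_ge0_lt1 sigma beta gamma : 0 < sigma -> sigma <= beta -> 0 < gamma ->
  0 <= delta sigma beta gamma < 1.
Proof.
move=> s0 sb g0; have b0 := lt_le_trans s0 sb.
have [le _] := optimal_value_le_delta s0 sb g0.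
have k1 : 1 <= Num.sqrt (beta / sigma).
  by rewrite -sqrtr1 ler_wsqrtr// ler_pdivlMr// mul1r.
apply/andP; split.
  by apply: le_trans le; rewrite divr_ge0 //; lra.
rewrite delta_mobius//; set M := Num.max _ _.
have M0 : 0 < M by rewrite lt_max mulr_gt0.
by rewrite ltr_pdivrMr; lra.
Qed.

Lemma optimalP sigma beta gamma alpha : 0 < sigma -> sigma <= beta ->
  optimal sigma beta gamma alpha <->
        gamma = 1 / Num.sqrt (sigma * beta) /\ alpha = 1.
Proof.
move=> s0 sb; have b0 := lt_le_trans s0 sb.
set go := 1 / _.
have go0 : 0 < go by rewrite divr_gt0// sqrtr_gt0 mulr_gt0.
have go1 : admissible sigma beta go 1.
  have /andP[d0 d1] := delta_ge0_lt1 s0 sb go0.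
  by split=> //; rewrite ltr01 ltr_pdivlMr ?mul1r; lra.
have bound g a : admissible sigma beta g a ->
    rate sigma beta go 1 <= rate sigma beta g a ?= iff (g == go) && (a == 1).
  case=> g0 /andP[a0 _]; have := delta_le_rate (delta_ge0_lt1 s0 sb g0) a0.
  apply: leif_trans.
  rewrite {1}/rate subrr normr0 add0r mul1r.
  have [_] := optimal_value_le_delta s0 sb go0; rewrite eqxx => /eqP <-.
  exact: optimal_value_le_delta.
split=> [[adm opt]|[-> ->]].
  by have := opt _ _ go1; rewrite (ge_leif (bound _ _ adm)) => /andP[/eqP-> /eqP->].
by split=> // g a /bound [].
Qed.

End OptimalParameters.

(** * Inner products *)

Section InnerProduct.
Context {R : realType} {H : normedModType R} (dot : {dot H for idfun}).
Context (dot_norm : forall x : H, dot x x = `|x| ^+ 2).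

Lemma dotC x y : dot x y = dot y x.
Proof. by rewrite hermC mul1r. Qed.

Definition dotE := (linearDl dot, linearDr dot, linearBl dot, linearBr dot,
  linearNl dot, linearNr dot, linearZl_LR dot, linearZr_LR dot).

Lemma sqnorm_conv (x y : H) t : `|t *: x + (1 - t) *: y| ^+ 2 =
  t * `|x| ^+ 2 + (1 - t) * `|y| ^+ 2 - t * (1 - t) * `|x - y| ^+ 2.
Proof. rewrite -!dot_norm !dotE /= (dotC y x) /GRing.scale/=; ring. Qed.

End InnerProduct.

(** * Minimization of strongly convex functions *)

(** Stands in for letting t tend to 0 in the convexity arguments below. *)
Lemma le0_of_linear_bound (R : realFieldType) (A B : R) :
  (forall t, 0 < t < 1 -> A <= t * B) -> A <= 0.
Proof.
move=> le; case: (lerP A 0) => // A0.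
(* For A > 0 the weight t = A / (A + |B| + 1) gives t B < A. *)
have D0 : 0 < A + `|B| + 1 by rewrite ltr_wpDl// addr_ge0// ltW.
have /le : 0 < A / (A + `|B| + 1) < 1.
  by rewrite divr_gt0//= ltr_pdivrMr// mul1r -addrA ltrDl ltr_wpDl.
rewrite mulrAC ler_pdivlMr// ler_pM2l// => le2.
by have := ler_norm B; lra.
Qed.

Section StrongConvexity.
Context {R : realType} {H : normedModType R}.
Implicit Types h phi : H -> \bar R.

(** The defining inequality of strong convexity with the quadratic already moved
    to the right, at points where phi is finite: this keeps the arithmetic in R
    and covers plain convexity as mu = 0. *)
Definition strongly_convex_on_dom mu phi := forall (x y : H) (t a b : R),
  0 < t < 1 -> phi x = a%:E -> phi y = b%:E ->
  (phi (t *: x + (1 - t) *: y)%R <=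
    (t * a + (1 - t) * b - mu / 2 * (t * (1 - t)) * `|x - y| ^+ 2)%:E)%E.

(** Compare p with t y + (1 - t) p, divide by t and let t tend to 0. *)
Lemma argmin_quadratic_growth mu phi p y a b : strongly_convex_on_dom mu phi ->
  argmin phi p -> phi p = a%:E -> phi y = b%:E ->
  a + mu / 2 * `|y - p| ^+ 2 <= b.
Proof.
move=> sc minp pa yb; rewrite -subr_le0.
apply: (@le0_of_linear_bound _ _ (mu / 2 * `|y - p| ^+ 2)) => t t01.
have := le_trans (minp _) (sc y p t b a t01 yb pa).
rewrite pa lee_fin => le; case/andP: t01 => t0 t1.
rewrite -(ler_pM2l t0); nra.
Qed.

(** Applied to proximal objectives, where q is half the squared distance to z. *)
Lemma lower_semicontinuousZD (h : H -> \bar R) (gamma : R) (q : H -> R) :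
  0 < gamma -> (forall x, h x != -oo%E) ->
  lower_semicontinuous h -> continuous q ->
  lower_semicontinuous (fun x => gamma%:E * h x + (q x)%:E)%E.
Proof.
move=> g0 hN lsc cq x a ax.
(* A real c below h x, so that h x = +oo needs no case distinction afterwards. *)
have [c cx ac] : exists2 c, (c%:E < h x)%E & a < gamma * c + q x.
  move: ax (hN x); case: (h x) => [b||] //=.
    rewrite -EFinM -EFinD lte_fin => ab _.
    exists (b - (gamma * b + q x - a) / (2 * gamma)).
      by rewrite lte_fin ltrBlDr ltrDl divr_gt0 ?mulr_gt0// subr_gt0.
    have -> : gamma * (b - (gamma * b + q x - a) / (2 * gamma)) =
      (gamma * b - q x + a) / 2 by field; rewrite gt_eqF.
    by lra.
  move=> _ _; exists ((a - q x + 1) / gamma); first exact: ltry.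
  have -> : gamma * ((a - q x + 1) / gamma) = a - q x + 1 by field; rewrite gt_eqF.
  by lra.
have [V Vx Vc] := lsc _ _ cx.
exists (V `&` [set y | a - gamma * c < q y]).
  apply: filterI => //.
  have : a - gamma * c < q x by rewrite ltrBlDl.
  by move=> /(cvgr_gt _ (cq x)).
move=> y [/Vc cy /=]; rewrite ltrBlDl => ay.
case: (h y) cy (hN y) => [b||] //=.
  rewrite lte_fin -EFinM -EFinD lte_fin => cb _.
  by apply: lt_trans ay _; rewrite ltrD2r ltr_pM2l.
by move=> _ _; rewrite gt0_muley ?lte_fin// addye// ltry.
Qed.

(** Lower semicontinuity bounds phi from below on a ball around a point x0 of the
    domain. Any other x is joined to x0 by a segment that meets the ball, and
    strong convexity along this segment bounds phi x below by a quadratic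
    function of |x - x0| with positive leading coefficient. *)
Lemma strongly_convex_bounded_below mu phi : 0 < mu ->
  strongly_convex_on_dom mu phi -> lower_semicontinuous phi ->
  (exists x, phi x \is a fin_num) -> (forall x, phi x != -oo%E) ->
  exists m, forall x, (m%:E <= phi x)%E.
Proof.
move=> mu0 sc lsc [x0 fin0] phiN.
have [c0 c0E] : exists c, phi x0 = c%:E by exists (fine (phi x0)); rewrite fineK.
have [|V /nbhs_normP[r /= r0 rV] Vc] := lsc x0 (c0 - 1).
  by rewrite c0E lte_fin; lra.
(* The minimum over D = |x - x0| of the quadratic
   c0 - 1 - 1/r - D/r + mu D^2 / (2 (r + 1)), found by completing the square. *)
exists (c0 - 1 - r^-1 - (r + 1) / (2 * mu * r ^+ 2)) => x.
case E : (phi x) (phiN x) => [a||] // _; last exact: leey.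
set D := `|x - x0|; have D0 : 0 <= D := normr_ge0 _.
(* This weight satisfies t D < r and stays in ]0, 1[ even if D = 0. *)
set t := r / (r + D + 1).
have S0 : 0 < r + D + 1 by lra.
have t0 : 0 < t by rewrite divr_gt0.
have t1 : t < 1 by rewrite ltr_pdivrMr//; lra.
have /Vc : V (t *: x + (1 - t) *: x0).
  apply: rV => /=.
  have -> : x0 - (t *: x + (1 - t) *: x0) = t *: (x0 - x).
    by rewrite scalerBl scale1r scalerBr opprD opprB addrCA subrKC addrC.
  rewrite normrZ gtr0_norm// distrC -/D /t mulrAC ltr_pdivrMr//.
  by rewrite ltr_pM2l//; lra.
have /sc /(_ E c0E) : 0 < t < 1 by rewrite t0.
move=> /[swap] /lt_le_trans /[apply].
rewrite lte_fin -/D lee_fin => le.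
have {le} : c0 - t^-1 + mu / 2 * (1 - t) * D ^+ 2 < a.
  rewrite -(ltr_pM2l t0).
  have -> : t * (c0 - t^-1 + mu / 2 * (1 - t) * D ^+ 2) =
     t * c0 - 1 + t * (mu / 2 * (1 - t) * D ^+ 2) by field; rewrite gt_eqF.
  lra.
have : D ^+ 2 / (r + 1) <= (1 - t) * D ^+ 2.
  rewrite mulrC ler_wpM2r ?sqr_ge0//.
  have -> : 1 - t = (D + 1) / (r + D + 1) by rewrite /t; field; rewrite gt_eqF.
  rewrite ler_pdivlMr// mulrC ler_pdivrMr; last lra.
  nra.
have -> : t^-1 = 1 + r^-1 + D / r by rewrite /t; field; rewrite !gt_eqF.
have : 0 <= mu / 2 * (D ^+ 2 / (r + 1)) - D / r + (r + 1) / (2 * mu * r ^+ 2).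
  have -> : mu / 2 * (D ^+ 2 / (r + 1)) - D / r + (r + 1) / (2 * mu * r ^+ 2) =
     (mu * r * D - (r + 1)) ^+ 2 / (2 * mu * (r + 1) * r ^+ 2).
    by field; rewrite !gt_eqF//; lra.
  by rewrite divr_ge0 ?sqr_ge0// !mulr_ge0 ?sqr_ge0//; lra.
move=> h1 h2 h3; apply: ltW; apply: le_lt_trans h3.
have : mu / 2 * (D ^+ 2 / (r + 1)) <= mu / 2 * ((1 - t) * D ^+ 2).
  by rewrite ler_pM2l// divr_gt0.
lra.
Qed.

End StrongConvexity.

Section Existence.
Context {R : realType} {H : completeNormedModType R}.

(** Strong convexity makes any minimizing sequence Cauchy: the midpoint of u i and
    u j cannot go below the infimum. Lower semicontinuity passes to the limit. *)
Theorem strongly_convex_attains_min mu (phi : H -> \bar R) : 0 < mu ->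
  strongly_convex_on_dom mu phi -> lower_semicontinuous phi ->
  (exists x, phi x \is a fin_num) -> (forall x, phi x != -oo%E) ->
  argmin phi !=set0.
Proof.
move=> mu0 sc lsc fin0 phiN.
have [m0 m0le] := strongly_convex_bounded_below mu0 sc lsc fin0 phiN.
pose V := [set v | exists x, phi x = v%:E].
have infV : has_inf V.
  split; first by case: fin0 => x fx; exists (fine (phi x)), x; rewrite fineK.
  by exists m0 => v [x xv]; rewrite -lee_fin -xv.
have lbV x : ((inf V)%:E <= phi x)%E.
  case E : (phi x) (phiN x) => [a||]// _; last exact: leey.
  by rewrite lee_fin; apply: ge_inf; [case: infV | exists x].
have /choice[u uP] n : exists x : H,
    exists2 v, phi x = v%:E & v < inf V + n.+1%:R^-1.
  have [//|v [x xv] lt] := inf_adherent (_ : 0 < n.+1%:R^-1) infV.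
  by exists x, v.
have gap i j : mu / 8 * `|u i - u j| ^+ 2 <= (i.+1%:R^-1 + j.+1%:R^-1) / 2.
  have [[a ia la] [b jb lb]] := (uP i, uP j).
  have half01 : 0 < (2^-1 : R) < 1 by apply/andP; split; lra.
  have := le_trans (lbV _) (sc _ _ _ _ _ half01 ia jb).
  rewrite lee_fin; move: (i.+1%:R^-1) (j.+1%:R^-1) la lb => ei ej la lb; lra.
have small_eventually (e : R) : 0 < e -> \forall n \near \oo, n.+1%:R^-1 < e.
  by move=> e0; exact: (near_infty_natSinv_lt (PosNum e0)).
have cvu : cvgn u.
  apply: cauchy_cvg; apply: cauchy_exP => e e0.
  have [|N _ NP] := small_eventually (mu / 8 * e ^+ 2).
    by rewrite mulr_gt0 ?divr_gt0 ?exprn_gt0.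
  exists (u N); exists N => // n /= Nn; rewrite -ball_normE /=.
  rewrite -(ltr_pXn2r (_ : 0 < 2)%N) ?nnegrE ?(ltW e0)//.
  have mu8 : 0 < mu / 8 by rewrite divr_gt0.
  rewrite -(ltr_pM2l mu8); apply: le_lt_trans (gap _ _) _.
  have := NP _ (leqnn N); have := NP _ Nn => /=.
  move: (n.+1%:R^-1) (N.+1%:R^-1) => en eN; lra.
exists (limn u) => y; rewrite (le_trans _ (lbV y))// leNgt; apply/negP => lt.
(* If phi were above inf V at the limit, then phi (u n) would eventually exceed
   a real c > inf V. *)
have [c ltc ctl] : exists2 c, inf V < c & (c%:E < phi (limn u))%E.
  case E : (phi (limn u)) lt => [b||] //.
    rewrite lte_fin => lt; exists ((inf V + b) / 2); last rewrite lte_fin.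
      by lra.
    by lra.
  by move=> _; exists (inf V + 1); [lra | exact: ltry].
have [W Wl Wc] := lsc _ _ ctl.
have : \forall n \near \oo, W (u n) /\ n.+1%:R^-1 < c - inf V.
  apply: filterI; first exact: cvu.
  by apply: small_eventually; rewrite subr_gt0.
case => N _ /(_ N (leqnn N)) [/Wc /= cN small].
have [v Nv lv] := uP N.
move: cN; rewrite Nv lte_fin; move: (N.+1%:R^-1) small lv => e; lra.
Qed.

End Existence.

(** * The proximal operator *)

Section Prox.
Context {R : realType} {H : completeNormedModType R} (dot : {dot H for idfun}).
Context (dot_norm : forall x : H, dot x x = `|x| ^+ 2).
Implicit Types h : H -> \bar R.

(** The quadratic terms combine through [sqnorm_conv]. *)
Lemma strongly_convex_dom sigma h :
  strongly_convex sigma h -> strongly_convex_on_dom sigma h.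
Proof.
move=> sc x y t a b t01 xa yb; move: (sc x y t t01).
rewrite xa yb -!EFinB -!EFinM -EFinD.
have /andP[t0 t1] := t01.
have := sqnorm_conv dot_norm x y t.
case: (h _) => [c||] //= ->.
  by rewrite !lee_fin; lra.
by move=> _; exact: leNye.
Qed.

Lemma convex_ext_dom h : convex_ext h -> strongly_convex_on_dom 0 h.
Proof.
move=> cv; apply: strongly_convex_dom => x y t t01.
by rewrite !mul0r !sube0; exact: cv.
Qed.

(** The squared distance contributes 1 to the modulus, again by [sqnorm_conv]. *)
Lemma prox_objective_strongly_convex sigma gamma h z : 0 < gamma ->
  (forall x, h x != -oo%E) ->
  strongly_convex_on_dom sigma h ->
  strongly_convex_on_dom (gamma * sigma + 1)
    (fun x => gamma%:E * h x + (2^-1 * `|x - z| ^+ 2)%:E)%E.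
Proof.
move=> g0 hN sc x y t a b t01.
case xE : (h x) (hN x) => [hx||]// _; last by rewrite gt0_muley ?lte_fin.
case yE : (h y) (hN y) => [hy||]// _; last by rewrite gt0_muley ?lte_fin.
rewrite -!EFinM -!EFinD => -[<-] [<-].
have := sc _ _ _ _ _ t01 xE yE.
case: (h _) (hN (t *: x + (1 - t) *: y)) => [c||]// _.
rewrite -EFinM -EFinD !lee_fin => le.
have -> : t *: x + (1 - t) *: y - z = t *: (x - z) + (1 - t) *: (y - z).
  by rewrite !scalerBr addrACA -opprD -scalerDl addrCA subrr addr0 scale1r.
rewrite (sqnorm_conv dot_norm) opprB addrA subrK.
have := ler_wpM2l (ltW g0) le; lra.
Qed.

Context (h : H -> \bar R) (gamma : R).
Context (gamma_gt0 : 0 < gamma) (h_pcc : proper_closed_convex h).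

(** The junk value in the definition of prox never occurs. *)
Lemma prox_argmin z :
  argmin (fun x => gamma%:E * h x + (2^-1 * `|x - z| ^+ 2)%:E)%E (prox gamma h z).
Proof.
have [[hN [x0 hx0]] lsc cv] := h_pcc.
rewrite /prox; case: xgetP => [x -> //|].
have [x minx] : argmin (fun x => gamma%:E * h x + (2^-1 * `|x - z| ^+ 2)%:E)%E !=set0.
  apply: (@strongly_convex_attains_min _ _ (gamma * 0 + 1)).
  - by rewrite mulr0 add0r.
  - exact: prox_objective_strongly_convex (convex_ext_dom cv).
  - apply: (lower_semicontinuousZD gamma_gt0 hN lsc) => x.
    apply: cvgM; first exact: cvg_cst.
    apply: cvgM; apply: cvg_norm; apply: cvgB (@cvg_cst _ _ _ _ _) => //.
  - exists x0; case: (h x0) (hN x0) hx0 => [c||]// _ _.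
  - move=> x; case: (h x) (hN x) => [c||]// _; by rewrite gt0_muley ?lte_fin.
by move=> /(_ x) /(_ minx).
Qed.

(** Quadratic growth of the objective from its minimizer p, with modulus
    gamma sigma + 1; expanding |y - z|^2 around p absorbs the 1 and leaves the
    subgradient inequality. *)
Lemma prox_variational sigma z : strongly_convex_on_dom sigma h ->
  exists2 c, h (prox gamma h z) = c%:E & forall y b, h y = b%:E ->
    gamma * c + dot (z - prox gamma h z) (y - prox gamma h z)
      + gamma * sigma / 2 * `|y - prox gamma h z| ^+ 2 <= gamma * b.
Proof.
move=> sc; have [[hN [x0 hx0]] lsc cv] := h_pcc.
have minp := prox_argmin z; set p := prox gamma h z in minp *.
have [c pc] : exists c, h p = c%:E.
  have := minp x0; case: (h p) (hN p) => [c||]// _; first by exists c.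
  rewrite gt0_muley ?lte_fin//; case: (h x0) (hN x0) hx0 => [b||]//.
exists c => // y b yb.
have := argmin_quadratic_growth (y := y)
  (prox_objective_strongly_convex (z := z) gamma_gt0 hN sc) minp.
rewrite pc yb -!EFinM -!EFinD => /(_ _ _ erefl erefl).
have -> : y - z = (y - p) - (z - p) by rewrite opprB addrA subrK.
rewrite -(normrN (p - z)) opprB.
move: (y - p) (z - p) => w s.
rewrite -!dot_norm !dotE /= (dotC _ w s).
lra.
Qed.

End Prox.

(** * Interpolation between smoothness and strong convexity *)

Section Interpolation.
Context {R : realType} {H : normedModType R} (dot : {dot H for idfun}).
Context (dot_norm : forall x : H, dot x x = `|x| ^+ 2).

(** Write p as a convex combination of y and p - s (y - p). The subgradient a
    bounds F below at the second point, so convexity of beta/2 |.|^2 - F bounds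
    F y above, up to an error that vanishes with s. Here a
    plays the role of the gradient of F at p. *)
Lemma quadratic_upper_bound (F : H -> R) beta p a :
  convex_function setT (fun x : H => beta / 2 * `|x| ^+ 2 - F x : R^o) ->
  (forall y, F p + dot a (y - p) <= F y) ->
  forall y, F y <= F p + dot a (y - p) + beta / 2 * `|y - p| ^+ 2.
Proof.
move=> cv sub y; rewrite -subr_le0.
apply: (@le0_of_linear_bound _ _ (beta / 2 * `|y - p| ^+ 2)) => s /andP[s0 s1].
have t0 : 0 <= s / (1 + s) by rewrite divr_ge0; lra.
have t1 : s / (1 + s) <= 1 by rewrite ler_pdivrMr; lra.
have sE : 1 - s / (1 + s) = (1 + s)^-1 by field; rewrite gt_eqF; lra.
have := cv (Itv01 t0 t1) y (p - s *: (y - p)) (in_setT _) (in_setT _).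
rewrite convRE /= /unstable.onem.
have vec w : s / (1 + s) *: (p + w) + (1 - s / (1 + s)) *: (p - s *: w) = p.
  rewrite scalerDr scalerBr addrACA -scalerDl subrKC scale1r scalerA -scalerBl sE.
  by rewrite mulrC subrr scale0r addr0.
have -> : (conv (Itv01 t0 t1) (y : convex_lmodType H) (p - s *: (y - p))) = p :> H.
  by rewrite -[RHS](vec (y - p)) subrKC.
have := sub (p - s *: (y - p)).
have -> : p - s *: (y - p) - p = - (s *: (y - p)) by rewrite addrC addKr.
have -> : `|y| ^+ 2 = `|p + (y - p)| ^+ 2 by rewrite subrKC.
move: (y - p) => w; move: (F (p - s *: w)) => v.
rewrite sE -!dot_norm !dotE /= (dotC _ w p) /GRing.scale /=.
have s10 : 0 < 1 + s by lra.
move=> h1; rewrite -(ler_pM2l s10).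
rewrite [leRHS](_ : _ =
    s * (beta / 2 * (dot p p + 2 * dot p w + dot w w) - F y) +
    (beta / 2 * (dot p p - 2 * s * dot p w + s ^+ 2 * dot w w) - v)); last first.
  by field; rewrite gt_eqF.
move=> h2; rewrite -(ler_pM2l s0); lra.
Qed.

(** The gradients a, b of a function that is sigma-strongly convex and
    beta-smooth are interpolated (cocoercivity of the gradient of
    F - sigma/2 |.|^2). At a common point, the lower bound issued from p lies
    below the upper bound issued from q, and conversely; the points q + t e' and
    p - t e', where e' is the gradient difference of F - sigma/2 |.|^2, are those
    where the two bounds are closest, for a suitable t. *)
Lemma gradient_interpolation (F : H -> R) sigma beta p q a b : sigma <= beta ->
  (forall y, F p + dot a (y - p) + sigma / 2 * `|y - p| ^+ 2 <= F y) ->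
  (forall y, F y <= F p + dot a (y - p) + beta / 2 * `|y - p| ^+ 2) ->
  (forall y, F q + dot b (y - q) + sigma / 2 * `|y - q| ^+ 2 <= F y) ->
  (forall y, F y <= F q + dot b (y - q) + beta / 2 * `|y - q| ^+ 2) ->
  0 <= dot ((a - b) - sigma *: (p - q)) (beta *: (p - q) - (a - b)).
Proof.
move=> sb lp up lq uq.
have [d dE] : exists d, d = p - q by eexists.
have [e' e'E] : exists e', e' = a - b - sigma *: d by eexists.
rewrite -dE -e'E.
have bound t : (2 * t - (beta - sigma) * t ^+ 2) * dot e' e' <= dot e' d.
  have := le_trans (lp _) (uq (q + t *: e')).
  have := le_trans (lq _) (up (p - t *: e')).
  have -> : q + t *: e' - p = t *: e' - d by rewrite dE opprB addrA (addrC q).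
  have -> : p - t *: e' - q = d - t *: e' by rewrite dE addrAC.
  have -> : q + t *: e' - q = t *: e' by rewrite addrC addKr.
  have -> : p - t *: e' - p = - (t *: e') by rewrite addrC addKr.
  have dot_e' w : dot e' w = dot a w - dot b w - sigma * dot d w.
    by rewrite e'E !dotE.
  rewrite -!dot_norm !dotE /= (dotC _ d e') /GRing.scale /=.
  have -> : dot a e' = dot e' e' + dot b e' + sigma * dot e' d.
    by rewrite (dotC _ e' d) dot_e'; ring.
  have -> : dot a d = dot e' d + dot b d + sigma * dot d d by rewrite dot_e'; ring.
  lra.
have -> : dot e' (beta *: d - (a - b)) = (beta - sigma) * dot e' d - dot e' e'.
  have -> : beta *: d - (a - b) = (beta - sigma) *: d - e'.
    by rewrite e'E (opprB (a - b)) addrA scalerBl subrK.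
  by rewrite !dotE.
have E0 : 0 <= dot e' e' by rewrite dot_norm sqr_ge0.
(* The best t is 1 / (beta - sigma); if sigma = beta there is no quadratic term
   and letting t grow forces e' = 0. *)
case: (ltrP sigma beta) => [lt|ge].
  have L0 : 0 < beta - sigma by rewrite subr_gt0.
  have := bound (beta - sigma)^-1; rewrite -(ler_pM2l L0).
  set L := beta - sigma.
  have -> : L * ((2 / L - L * L^-1 ^+ 2) * dot e' e') = dot e' e'.
    by field; rewrite gt_eqF.
  by rewrite subr_ge0.
have L0 : beta - sigma = 0 by lra.
rewrite L0 mul0r sub0r oppr_ge0.
move: bound; rewrite L0 => bound; case: (lerP (dot e' e') 0) => // Epos.
(* A t for which the bound reads dot e' d + 1 <= dot e' d. *)
have := bound ((dot e' d + 1) / (2 * dot e' e')).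
rewrite mul0r subr0.
have -> : 2 * ((dot e' d + 1) / (2 * dot e' e')) * dot e' e' = dot e' d + 1.
  by field; rewrite gt_eqF.
by lra.
Qed.

(** In terms of u = d + e and v = d - e, the factors of the inner product are
    positive multiples of y u - v and x u + v, where x and y are the arguments of
    the maximum. So v lies in the ball having the segment from - x u to y u as
    a diameter, all of whose points have norm at most max (x, y) |u|. *)
Lemma reflection_contraction (d e : H) s b :
  0 < s -> s <= b ->
  0 <= dot (e - s *: d) (b *: d - e) ->
  `|d - e| <= Num.max ((b - 1) / (b + 1)) ((1 - s) / (1 + s)) * `|d + e|.
Proof.
move=> s0 sb ip; set x := (b - 1) / _; set y := (1 - s) / _.
have b0 := lt_le_trans s0 sb.
have xy0 : 0 <= x + y.
  have -> : x + y = 2 * (b - s) / ((b + 1) * (1 + s)).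
    by rewrite /x /y; field; rewrite !gt_eqF//; lra.
  by rewrite divr_ge0// mulr_ge0//; lra.
have [u uE] : exists u, u = d + e by eexists.
have [v vE] : exists v, v = d - e by eexists.
rewrite -uE -vE.
(* The ball is centred at the midpoint of its diameter. *)
have : `|v - ((y - x) / 2) *: u| ^+ 2 <= ((x + y) / 2 * `|u|) ^+ 2.
  have : 0 <= dot (y *: u - v) (x *: u + v).
    have -> : y *: u - v = (2 / (1 + s)) *: (e - s *: d).
      have -> : y *: u - v = (y - 1) *: d + (y + 1) *: e.
        by rewrite uE vE scalerBl scalerDl !scale1r scalerDr opprB [e - d]addrC addrACA.
      rewrite scalerBr scalerA addrC -scaleNr.
      by congr (_ *: _ + _ *: _); rewrite /y; field; rewrite gt_eqF//; lra.
    have -> : x *: u + v = (2 / (b + 1)) *: (b *: d - e).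
      have -> : x *: u + v = (x + 1) *: d + (x - 1) *: e.
        by rewrite uE vE scalerBl scalerDl !scale1r scalerDr addrACA.
      rewrite scalerBr scalerA -[in RHS]scaleNr.
      by congr (_ *: _ + _ *: _); rewrite /x; field; rewrite gt_eqF//; lra.
    rewrite linearZl_LR linearZr_LR /=.
    by do 2 (apply: mulr_ge0; first by apply: divr_ge0; lra).
  clear uE vE; rewrite exprMn -!dot_norm !dotE /= (dotC _ v u) /GRing.scale /=; lra.
rewrite ler_sqr ?nnegrE ?mulr_ge0// ?divr_ge0// => le.
rewrite maxr_absE.
have := ler_normD (v - ((y - x) / 2) *: u) (((y - x) / 2) *: u).
rewrite subrK normrZ normrM (@ger0_norm _ 2^-1) // (distrC y x).
lra.
Qed.

End Interpolation.

(** * Lipschitz constants of the reflections *)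

Section Reflection.
Context {R : realType} {H : completeNormedModType R} (dot : {dot H for idfun}).
Context (dot_norm : forall x : H, dot x x = `|x| ^+ 2).
Implicit Types h : H -> \bar R.

Lemma reflected_proxB gamma h z w :
  reflected_prox gamma h z - reflected_prox gamma h w =
  (prox gamma h z - prox gamma h w) -
  ((z - prox gamma h z) - (w - prox gamma h w)).
Proof.
have RE x : reflected_prox gamma h x = prox gamma h x - (x - prox gamma h x).
  by rewrite /reflected_prox scaler_nat mulr2n opprB addrA.
have swap (a b c d : H) : a - b - (c - d) = a - c - (b - d).
  by rewrite opprD addrACA -opprD.
by rewrite !RE swap.
Qed.

Lemma prox_residualB gamma h z w :
  z - w = (prox gamma h z - prox gamma h w) +
  ((z - prox gamma h z) - (w - prox gamma h w)).
Proof. by rewrite addrACA -opprD !subrKC. Qed.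

(** Adding the subgradient inequalities at the two proximal points gives
    <d, e> >= 0 in the notation d, e = u - v of differences of proximal points
    and of residuals. *)
Lemma reflected_prox_nonexpansive gamma h z w : 0 < gamma ->
  proper_closed_convex h ->
  `|reflected_prox gamma h z - reflected_prox gamma h w| <= `|z - w|.
Proof.
move=> g0 pcc; rewrite reflected_proxB.
have cv : strongly_convex_on_dom 0 h by case: pcc => _ _; exact: convex_ext_dom.
have [c pc hp] := prox_variational dot_norm g0 pcc z cv.
have [c' qc hq] := prox_variational dot_norm g0 pcc w cv.
move: (hp _ _ qc) (hq _ _ pc).
rewrite [z - w](prox_residualB gamma h).
rewrite -[prox gamma h w - prox gamma h z]opprB.
move: (prox gamma h z - prox gamma h w) (z - prox gamma h z)
  (w - prox gamma h w) => d u v.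
rewrite !mulr0 !mul0r !addr0 => h1 h2.
rewrite -ler_sqr ?nnegrE// -!dot_norm.
move: h1 h2; rewrite !dotE /= (dotC _ d u) (dotC _ d v); lra.
Qed.

Lemma reflected_prox_contraction sigma beta gamma (f : H -> \bar R) z w :
  0 < sigma -> sigma <= beta -> 0 < gamma ->
  proper_closed_convex f -> strongly_convex sigma f -> smooth beta f ->
  `|reflected_prox gamma f z - reflected_prox gamma f w| <=
     delta sigma beta gamma * `|z - w|.
Proof.
move=> s0 sb g0 pcc sc [fin _ cv]; rewrite reflected_proxB.
have bound x : let p := prox gamma f x in let a := gamma^-1 *: (x - p) in
    forall y, fine (f p) + dot a (y - p) + sigma / 2 * `|y - p| ^+ 2 <= fine (f y).
  move=> p a y; have [c pc hp] :=
    prox_variational dot_norm g0 pcc x (strongly_convex_dom dot_norm sc).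
  have := hp y (fine (f y)); rewrite fineK// => /(_ erefl) le.
  rewrite -(ler_pM2l g0) pc /a linearZl_LR /=.
  have -> : gamma * (c + gamma^-1 * dot (x - p) (y - p) + sigma / 2 * `|y - p| ^+ 2) =
    gamma * c + dot (x - p) (y - p) + gamma * sigma / 2 * `|y - p| ^+ 2.
    by field; rewrite gt_eqF.
  exact: le.
have upper x : let p := prox gamma f x in let a := gamma^-1 *: (x - p) in
    forall y, fine (f y) <= fine (f p) + dot a (y - p) + beta / 2 * `|y - p| ^+ 2.
  move=> p a; apply: (quadratic_upper_bound dot_norm cv) => y.
  apply: le_trans (bound x y); rewrite lerDl mulr_ge0 ?sqr_ge0// divr_ge0// ltW//.
have := gradient_interpolation dot_norm sb (bound z) (upper z) (bound w) (upper w).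
rewrite -scalerBr.
rewrite [z - w](prox_residualB gamma f).
move: (prox gamma f z - prox gamma f w) (_ - _) => d e ip.
rewrite /delta; apply: (reflection_contraction dot_norm); first by rewrite mulr_gt0.
  by rewrite ler_pM2l.
have -> : e - (gamma * sigma) *: d = gamma *: (gamma^-1 *: e - sigma *: d).
  by rewrite scalerBr !scalerA mulfV ?gt_eqF// scale1r.
have -> : (gamma * beta) *: d - e = gamma *: (beta *: d - gamma^-1 *: e).
  by rewrite scalerBr !scalerA mulfV ?gt_eqF// scale1r.
by rewrite linearZl_LR linearZr_LR /= !mulr_ge0 // ltW.
Qed.

End Reflection.

(** * Rate bound and its optimum *)

(* A real Hilbert space is a complete normed space H with an inner product dot
   inducing its norm. *)
Theorem proposition3 (R : realType) (H : completeNormedModType R)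
    (dot : {dot H for idfun}) (dot_norm : forall x : H, dot x x = `|x| ^+ 2)
    (f g : H -> \bar R) (sigma beta : R)
    (sigma_gt0 : 0 < sigma) (sigma_le_beta : sigma <= beta)
    (f_pcc : proper_closed_convex f) (g_pcc : proper_closed_convex g)
    (f_strong : strongly_convex sigma f) (f_smooth : smooth beta f) :
  [/\ forall gamma alpha : R, admissible sigma beta gamma alpha ->
        is_rate_bound gamma alpha f g (rate sigma beta gamma alpha),
      forall gamma alpha : R, optimal sigma beta gamma alpha <->
        gamma = 1 / Num.sqrt (sigma * beta) /\ alpha = 1
    & rate sigma beta (1 / Num.sqrt (sigma * beta)) 1 =
        (Num.sqrt (beta / sigma) - 1) / (Num.sqrt (beta / sigma) + 1)].
Proof.
split.
- move=> gamma alpha [gamma_gt0 /andP[alpha_gt0 _]] zbar fix_zbar z DR k.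
  have -> : z k.+1 - zbar = (1 - alpha) *: (z k - zbar) + alpha *:
      (reflected_prox gamma g (reflected_prox gamma f (z k)) -
       reflected_prox gamma g (reflected_prox gamma f zbar)).
    rewrite DR fix_zbar !scalerBr addrACA -opprD -scalerDl.
    by rewrite [1 - alpha + alpha]subrK scale1r.
  apply: le_trans (ler_normD _ _) _.
  rewrite !normrZ [rate _ _ _ _ * _]mulrDl lerD2l (gtr0_norm alpha_gt0).
  rewrite -mulrA ler_pM2l//.
  apply: le_trans (reflected_prox_nonexpansive dot_norm _ _ gamma_gt0 g_pcc) _.
  exact: (reflected_prox_contraction dot_norm).
- by move=> gamma alpha; exact: optimalP.
- have b0 := lt_le_trans sigma_gt0 sigma_le_beta.
  have gamma_gt0 : 0 < 1 / Num.sqrt (sigma * beta).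
    by rewrite divr_gt0// sqrtr_gt0 mulr_gt0.
  rewrite /rate subrr normr0 add0r mul1r; apply/esym/eqP.
  by rewrite (eq_leif (optimal_value_le_delta _ _ _)).
Qed.
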